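(* Let $(E',\mathcal{L}')$ be a COM, let $S^+,S^-\subseteq E'$ be disjoint, let $E=E'\setminus(S^+\cup S^-)$ and $\mathcal{L}=\rho_{(S^+,S^-)}(\mathcal{L}')$, and suppose $(E,\mathcal{L})$ is a COM. Suppose the set $\mathcal{T}$ of topes of $\mathcal{L}$ is non-empty, and let $R\in\{+,-\}^E$ be a sign pattern such that $R=R'|_E$ for some tope $R'$ of $\mathcal{L}'$. Then the order complex of the poset $\mathcal{T}_R$ is contractible.
   Context: Sign vectors: for $X,Y\in\{0,+,-\}^E$, composition $(X\circ Y)_e=X_e$ if $X_e\neq0$ else $Y_e$; separator $S(X,Y)=\{e: X_e=-Y_e\neq0\}$. A COM is $(E,\mathcal{L})$, $E$ finite, $\mathcal{L}\subseteq\{0,+,-\}^E$, satisfying (FS): $X\circ(-Y)\in\mathcal{L}$ for all $X,Y\in\mathcal{L}$, and (SE): for all $X,Y\in\mathcal{L}$, $e\in S(X,Y)$ there is $Z\in\mathcal{L}$ with $Z_e=0$ and $Z_f=(X\circ Y)_f$ for $f\notin S(X,Y)$. Topes are covectors with no zero entries. For $X$ a sign vector and $A\subseteq E$, $X|_A$ is its restriction to coordinates in $A$. The restriction (topal fiber) $\rho_{(S^+,S^-)}(\mathcal{L}')$ is the set $\{X|_{E'\setminus(S^+\cup S^-)} : X\in\mathcal{L}',\ X_e=+ \text{ for } e\in S^+,\ X_e=- \text{ for } e\in S^-\}$; its topes correspond to topes of $\mathcal{L}'$ positive on $S^+$ and negative on $S^-$. For $R\in\{+,-\}^E$, $\mathcal{T}_R$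 denotes $\mathcal{T}$ partially ordered by $P\preceq_R Q$ iff $S(R,P)\subseteq S(R,Q)$. The order complex of a poset is the simplicial complex whose faces are its chains. *)

(* Defs.v *)
From HB Require Import structures.
From mathcomp Require Import all_boot all_order all_algebra.
From mathcomp Require Import all_classical all_reals all_analysis.

Set Implicit Arguments.
Unset Strict Implicit.
Unset Printing Implicit Defensive.

Import Order.TTheory GRing.Theory Num.Theory.
Import numFieldNormedType.Exports.

Local Open Scope ring_scope.

Variant sign := Zero | Pos | Neg.

Definition option_of_sign (s : sign) : option bool :=
  match s with Zero => None | Pos => Some true | Neg => Some false end.

Definition sign_of_option (o : option bool) : sign :=
  match o with None => Zero | Some true => Pos | Some false => Neg end.

Lemma option_of_signK : cancel option_of_sign sign_of_option.
Proof. by case. Qed.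

HB.instance Definition _ := Finite.copy sign (can_type option_of_signK).

Definition sign_opp (s : sign) : sign :=
  match s with Zero => Zero | Pos => Neg | Neg => Pos end.

Notation signvec E := {ffun E -> sign}.

Definition sv_opp (E : finType) (X : signvec E) : signvec E :=
  [ffun e => sign_opp (X e)].

Definition sv_comp (E : finType) (X Y : signvec E) : signvec E :=
  [ffun e => if X e != Zero then X e else Y e].

Definition separator (E : finType) (X Y : signvec E) : {set E} :=
  [set e | (X e == sign_opp (Y e)) && (X e != Zero)]%SET.

Definition face_symmetry (E : finType) (L : {set signvec E}) : Prop :=
  forall X Y, X \in L -> Y \in L -> sv_comp X (sv_opp Y) \in L.

Definition strong_elimination (E : finType) (L : {set signvec E}) : Prop :=
  forall X Y, X \in L -> Y \in L -> forall e, e \in separator X Y ->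
    exists Z, [/\ Z \in L, Z e = Zero &
      forall f, f \notin separator X Y -> Z f = sv_comp X Y f].

Definition is_COM (E : finType) (L : {set signvec E}) : Prop :=
  face_symmetry L /\ strong_elimination L.

Definition nowhere_zero (E : finType) (X : signvec E) : bool :=
  [forall e, X e != Zero].

Definition topes (E : finType) (L : {set signvec E}) : {set signvec E} :=
  [set X in L | nowhere_zero X]%SET.

(* Coordinates of a restriction are indexed by the subtype of the elements
   of A. *)
Definition sv_restrict (E : finType) (A : {set E}) (X : signvec E) :
    signvec {e : E | e \in A} :=
  [ffun e => X (val e)].

Definition topal_fiber (E : finType) (Sp Sm : {set E}) (L : {set signvec E}) :
    {set signvec {e : E | e \in ~: (Sp :|: Sm)%SET}} :=
  [set sv_restrict (~: (Sp :|: Sm)) X | X in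
    [set X in L | [forall e in Sp, X e == Pos] &&
                  [forall e in Sm, X e == Neg]]]%SET.

Definition sign_pattern (E : finType) := {R : signvec E | nowhere_zero R}.

(* The parameter R does not affect the carrier; it selects the order. *)
Definition tope_poset (E : finType) (L : {set signvec E})
    (R : sign_pattern E) : Type :=
  {P : signvec E | P \in topes L}.

Fact tope_display : Order.disp_t. Proof. exact: Order.Disp tt tt. Qed.

Section TopePoset.
Context (E : finType) (L : {set signvec E}) (R : sign_pattern E).
Implicit Types P Q : tope_poset L R.

HB.instance Definition _ :=
  Finite.copy (tope_poset L R) {P : signvec E | P \in topes L}.

Definition tope_le P Q : bool :=
  separator (val R) (sval P) \subset separator (val R) (sval Q).

Fact tope_le_refl : reflexive tope_le.
Proof. by move=> P; exact: subxx. Qed.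

Fact tope_le_anti : antisymmetric tope_le.
Proof.
move=> [P PL] [Q QL]; rewrite /tope_le /= => /andP[PQ QP]; apply: val_inj => /=.
have /setP sPQ : separator (val R) P = separator (val R) Q.
  by apply/eqP; rewrite finset.eqEsubset PQ.
apply/ffunP => e; have := sPQ e; rewrite !inE.
move: PL QL (valP R); rewrite !inE => /andP[_ /forallP/(_ e)].
move=> + /andP[_ /forallP/(_ e)] + /forallP/(_ e).
by case: (P e) (Q e) (val R e) => [] [] [].
Qed.

Fact tope_le_trans : transitive tope_le.
Proof. by move=> Q P S; exact: fintype.subset_trans. Qed.

HB.instance Definition _ := Order.Le_isPOrder.Build tope_display
  (tope_poset L R) tope_le_refl tope_le_anti tope_le_trans.

End TopePoset.

Definition order_complex (d : Order.disp_t) (P : finPOrderType d) :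
    {set {set P}} :=
  [set C : {set P} | [forall x in C, forall y in C, (x >=< y)%O]]%SET.

Local Open Scope classical_set_scope.

(* Barycentric coordinates; it is immaterial whether set0 belongs to K, since
   the support of a point is never empty. *)
Definition realization_set (R : realType) (V : finType) (K : {set {set V}}) :
    set {ptws V -> R} :=
  [set x | [/\ forall v, 0 <= x v, \sum_v x v = 1 &
               [set v | x v != 0]%SET \in K]].

(* As V is finite, the topology of pointwise convergence is the Euclidean one;
   set_type carries the subspace topology. *)
Definition realization (R : realType) (V : finType) (K : {set {set V}}) :
    topologicalType :=
  set_type (@realization_set R V K).

(* The values of H at times outside [0, 1] are irrelevant. *)
Definition contractible (R : realType) (X : topologicalType) : Prop :=
  exists (x0 : X) (H : R * X -> X),
    [/\ {within `[0, 1] `*` [set: X], continuous H},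
        forall x, H (0, x) = x &
        forall x, H (1, x) = x0].

Arguments realization R {V} K.

(* Main.v *)
(* Writing B for the tope R' and encoding a tope X by the set S(B, X), the
   fibre becomes the family C_S of all tope sets P containing a fixed set S,
   ordered by inclusion, for a COM in which B is a tope (the prescribed signs
   agreeing with B only cut out a smaller COM). Let F be the set of free
   elements. If S or S u F is a tope set, then C_S is a cone. Otherwise strong
   elimination gives e in F \ S with S u {e} not a tope set. The map
   P |-> P \ {e} sends C_S onto the corresponding family of the COM with e
   deleted, and its upper fibres are the families C_Q with Q = P \ {e} strictly
   larger than S; all of these are contractible by induction on |F \ S|, so
   Quillen's fibre lemma applies. That lemma is obtained from the topology by
   adding beat points to, and removing weak points from, a common family
   containing both C_S and its image. *)
Require Import Defs.
From mathcomp Require Import all_boot all_order all_algebra.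
From mathcomp Require Import all_classical all_reals all_analysis.
From mathcomp Require Import ring lra.

Set Implicit Arguments.
Unset Strict Implicit.
Unset Printing Implicit Defensive.

Import Order.TTheory GRing.Theory Num.Theory.
Import numFieldNormedType.Exports.

(** * Contractions of sets of points in a coordinate space *)

Section Contraction.
Local Open Scope classical_set_scope.
Local Open Scope ring_scope.
Context (R : realType) (V : finType).
Implicit Types (A B : set (V -> R)) (H : R -> (V -> R) -> V -> R).

(** Continuity is tested along arbitrary filters, coordinate by coordinate, so that composites need
    no subspace topology on [A] or on the time interval. *)
Definition jointly_continuous A H : Prop :=
  forall (T : Type) (F : set_system T) (FF : Filter F)
    (s : T -> R) (f : T -> V -> R) (t : R) (y : V -> R),
    0 <= t <= 1 -> A y ->
    (\forall x \near F, 0 <= s x <= 1) -> (\forall x \near F, A (f x)) ->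
    s x @[x --> F] --> t -> (forall v, f x v @[x --> F] --> y v) ->
    forall v, H (s x) (f x) v @[x --> F] --> H t y v.

Definition contractible_in A : Prop :=
  exists (a : V -> R) H,
    [/\ A a, forall (t : R) (y : V -> R), 0 <= t <= 1 -> A y -> A (H t y),
        forall y, A y -> H 0 y = y, forall y, A y -> H 1 y = a &
        jointly_continuous A H].

Definition continuous_on A (f : (V -> R) -> V -> R) : Prop :=
  forall (T : Type) (F : set_system T) (FF : Filter F) (g : T -> V -> R) (y : V -> R),
    A y -> (\forall x \near F, A (g x)) ->
    (forall v, g x v @[x --> F] --> y v) ->
    forall v, f (g x) v @[x --> F] --> f y v.

(** Following the contraction of [B] by [r] keeps it in [A], and it still starts at the identity
    because [r] fixes [A]. *)
Lemma contractible_in_retract A B (r : (V -> R) -> V -> R) :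
  A `<=` B -> (forall y, B y -> A (r y)) -> (forall y, A y -> r y = y) ->
  continuous_on B r -> contractible_in B -> contractible_in A.
Proof.
move=> AB rA rid rc [b [H [Bb HB H0 H1 Hc]]].
exists (r b), (fun t y => r (H t y)); split.
- exact: rA.
- by move=> t y t01 /AB By; apply: rA; exact: HB.
- by move=> y Ay; rewrite H0 ?rid //; exact: AB.
- by move=> y /AB By; rewrite H1.
move=> T F FF s f t y t01 /AB By s01 fA st fy.
have fB : \forall x \near F, B (f x) by apply: filterS fA => x; exact: AB.
apply: rc; first exact: HB.
- by near=> x; apply: HB; [near: x|near: x].
- exact: Hc.
Unshelve. all: by end_near. Qed.

Lemma cvg_min (T : Type) (F : set_system T) (FF : Filter F) (f g : T -> R) a b :
  f x @[x --> F] --> a -> g x @[x --> F] --> b ->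
  Num.min (f x) (g x) @[x --> F] --> Num.min a b.
Proof.
move=> fa gb.
exact: (@continuous2_cvg T R R R F FF f g (@Order.min _ R) a b (@min_continuous _ R (a, b)) fa gb).
Qed.

Lemma cvg_max (T : Type) (F : set_system T) (FF : Filter F) (f g : T -> R) a b :
  f x @[x --> F] --> a -> g x @[x --> F] --> b ->
  Num.max (f x) (g x) @[x --> F] --> Num.max a b.
Proof.
move=> fa gb.
exact: (@continuous2_cvg T R R R F FF f g (@Order.max _ R) a b (@max_continuous _ R (a, b)) fa gb).
Qed.

(* The two homotopies are concatenated by adding up their displacements, so
   that no gluing of continuous functions is needed. *)
Lemma contractible_in_deformation A B D :
  A `<=` B -> (forall (t : R) (y : V -> R), 0 <= t <= 1 -> B y -> B (D t y)) ->
  (forall y, B y -> D 0 y = y) -> (forall y, B y -> A (D 1 y)) ->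
  jointly_continuous B D -> contractible_in A -> contractible_in B.
Proof.
move=> AB DB D0 D1 Dc [a [H [Aa HA H0 H1 Hc]]].
(* [l] runs during the first half of the time and [m] during the second. By [lm] one of them is
   always at rest, so the sum of displacements is either [D (l t) y] or [H (m t) (D 1 y)]. *)
pose l (t : R) : R := Num.min 1 (2 * t); pose m (t : R) : R := Num.max 0 (2 * t - 1).
have l01 (t : R) : 0 <= t <= 1 -> 0 <= l t <= 1.
  by move=> t01; rewrite /l; case: (leP 1 (2 * t)) => ?; lra.
have m01 (t : R) : 0 <= t <= 1 -> 0 <= m t <= 1.
  by move=> t01; rewrite /m; case: (leP 0 (2 * t - 1)) => ?; lra.
have lm (t : R) : l t = 1 \/ m t = 0.
  rewrite /l /m; case: (leP 1 (2 * t)) => ?; [by left|right].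
  by case: (leP 0 (2 * t - 1)) => ?; lra.
exists a, (fun t y v => D (l t) y v + (H (m t) (D 1 y) v - D 1 y v)); split.
- exact: AB.
- move=> t y t01 By; have [lt1|mt0] := lm t.
    have -> : (fun v => D (l t) y v + (H (m t) (D 1 y) v - D 1 y v)) =
              H (m t) (D 1 y) by apply/funext => v; rewrite lt1; ring.
    by apply/AB/HA; [exact: m01|exact: D1].
  have -> : (fun v => D (l t) y v + (H (m t) (D 1 y) v - D 1 y v)) = D (l t) y.
    by apply/funext => v; rewrite mt0 H0 ?subrr ?addr0 //; exact: D1.
  by apply: DB => //; exact: l01.
- move=> y By; apply/funext => v.
  have -> : l 0 = 0 by rewrite /l mulr0; case: (leP 1 (0 : R)) => ?; lra.
  have -> : m 0 = 0 by rewrite /m; case: (leP (0:R) (2 * 0 - 1)) => ?; lra.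
  by rewrite D0 // H0 ?subrr ?addr0 //; exact: D1.
- move=> y By; apply/funext => v.
  have -> : l 1 = 1 by rewrite /l; case: (leP 1 (2 * (1 : R))) => ?; lra.
  have -> : m 1 = 1 by rewrite /m; case: (leP (0:R) (2 * 1 - 1)) => ?; lra.
  by rewrite H1; [ring|exact: D1].
move=> T F FF s f t y t01 By s01 fB st fy v.
have fD v' : D 1 (f x) v' @[x --> F] --> D 1 y v'.
  apply: (Dc _ _ _ (fun=> 1)) => //; first by lra.
    by apply: nearW => x; lra.
  exact: cvg_cst.
have sl : l (s x) @[x --> F] --> l t.
  by apply: cvg_min; [exact: cvg_cst|apply: cvgM => //; exact: cvg_cst].
have sm : m (s x) @[x --> F] --> m t.
  apply: cvg_max; first exact: cvg_cst.
  by apply: cvgB; [apply: cvgM => //; exact: cvg_cst|exact: cvg_cst].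
apply: cvgD; [apply: Dc => //|apply: cvgB; [apply: Hc => //|exact: fD]].
- exact: l01.
- by apply: filterS s01 => x; exact: l01.
- exact: m01.
- exact: D1.
- by apply: filterS s01 => x; exact: m01.
- by apply: filterS fB => x; exact: D1.
Qed.

End Contraction.

(** * Clique complexes: cones, beat points and weak points *)

Section CliqueComplex.
Local Open Scope classical_set_scope.
Local Open Scope ring_scope.
Context (R : realType) (V : finType) (r : rel V).
Hypotheses (rxx : reflexive r) (rsym : symmetric r).
Implicit Types (A N : {set V}) (y : V -> R).

(** The vertices range over a subset [A] of a fixed [V], so that complexes with different vertices
    share one coordinate space. With comparability as [r], the cliques are the chains. *)
Definition clique_pts A : set (V -> R) :=
  [set y | [/\ forall v, 0 <= y v, \sum_v y v = 1,
    forall v, y v != 0 -> v \in A &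
    forall u v, y u != 0 -> y v != 0 -> r u v]].

Lemma clique_pts_le1 A y v : clique_pts A y -> y v <= 1.
Proof.
case=> y0 y1 _ _; rewrite -y1 (bigD1 v) //= lerDl; exact: sumr_ge0.
Qed.

Lemma clique_pts_sub A A' : A \subset A' -> clique_pts A `<=` clique_pts A'.
Proof.
by move=> /fintype.subsetP sA y [y0 y1 yA yr]; split=> // v /yA /sA.
Qed.

Lemma clique_pts_setU1 A x y :
  clique_pts (x |: A)%SET y -> y x = 0 -> clique_pts A y.
Proof.
move=> [y0 y1 yA yr] yx; split=> // v yv; have := yA _ yv.
by rewrite in_setU1 => /orP[/eqP vx|//]; rewrite vx yx eqxx in yv.
Qed.

(** The straight-line homotopy to the vertex [x] adds only [x] to the support, and [x] is adjacent
    to all of [A]. *)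
Lemma contractible_cone A x :
  x \in A -> (forall u, u \in A -> r x u) -> contractible_in (clique_pts A).
Proof.
move=> xA xr; pose d v : R := (v == x)%:R.
have dx v : d v != 0 -> v = x by rewrite /d; case: (v =P x) => // _; rewrite eqxx.
have d1 : \sum_v d v = 1.
  by rewrite (bigD1 x) //= /d eqxx big1 ?addr0 // => v /negPf ->.
exists d, (fun t y v => (1 - t) * y v + t * d v); split.
- split=> //.
  + by move=> v vd; rewrite (dx v vd).
  + by move=> u v ud vd; rewrite (dx u ud) (dx v vd).
- move=> t y t01 [y0 y1 yA yr].
  have supp v : (1 - t) * y v + t * d v != 0 -> v = x \/ y v != 0.
    have [->|vx] := eqVneq v x; first by left.
    rewrite /d (negPf vx) mulr0 addr0 mulf_eq0 negb_or => /andP[_ ?].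
    by right.
  split=> [v|||].
  + have d0 : 0 <= d v by rewrite /d; case: (v == x); rewrite ?ler01.
    by rewrite addr_ge0 // mulr_ge0 //; lra.
  + by rewrite big_split /= -!mulr_sumr y1 d1; ring.
  + by move=> v /supp[->//|/yA].
  + move=> u v /supp[->|yu] /supp[->//|yv]; first by apply/xr/yA.
      by rewrite rsym; apply/xr/yA.
    exact: yr.
- by move=> y _; apply/funext => v; ring.
- by move=> y _; apply/funext => v; ring.
move=> T F FF s f t y _ _ _ _ st fy v.
apply: cvgD; apply: cvgM => //; last exact: cvg_cst.
by apply: cvgB => //; exact: cvg_cst.
Qed.

(** The mass of [x] slides along the edge to [x']. Supports stay cliques since the neighbours of [x]
    in [A] are neighbours of [x'], and at time 1 no mass is left at [x]. *)
Lemma contractible_beat_point A x x' :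
  x \notin A -> x' \in A -> r x x' ->
  (forall u, u \in A -> r x u -> r x' u) ->
  contractible_in (clique_pts A) -> contractible_in (clique_pts (x |: A)%SET).
Proof.
move=> xA x'A xx' xr.
have nxx' : x' != x by apply: contraNneq xA => <-.
pose D (t : R) y v := y v + t * (y x * ((v == x')%:R - (v == x)%:R)) : R.
have Dx (t : R) y : D t y x = (1 - t) * y x.
  by rewrite /D eqxx eq_sym (negPf nxx') /=; ring.
have Dx' (t : R) y : D t y x' = y x' + t * y x.
  by rewrite /D eqxx (negPf nxx') /=; ring.
have Dv t y v : v != x -> v != x' -> D t y v = y v.
  by rewrite /D => /negPf -> /negPf -> /=; ring.
have Dsum t y : \sum_v D t y v = \sum_v y v.
  have e w : \sum_v (v == w)%:R = 1 :> R.
    by rewrite (bigD1 w) //= eqxx big1 ?addr0 // => v /negPf ->.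
  rewrite big_split /= -!mulr_sumr big_split /= sumrN !e; ring.
have DB (t : R) y : 0 <= t <= 1 -> clique_pts (x |: A)%SET y ->
    clique_pts (x |: A)%SET (D t y).
  move=> t01 [y0 y1 yA yr].
  have supp v : D t y v != 0 -> y v != 0 \/ (v = x' /\ y x != 0).
    have [->|vx] := eqVneq v x.
      by rewrite Dx mulf_eq0 negb_or => /andP[_ ?]; left.
    have [->|vx'] := eqVneq v x'; last by rewrite Dv //; left.
    rewrite Dx'; have [->|] := eqVneq (y x) 0; last by right.
    by rewrite mulr0 addr0; left.
  have adj u : y x != 0 -> y u != 0 -> r x' u.
    move=> yx yu; have := yA _ yu; rewrite in_setU1 => /orP[/eqP->|uA].
      by rewrite rsym.
    by apply: xr => //; exact: yr.
  split=> [v|||].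
  + have [->|vx] := eqVneq v x; first by rewrite Dx mulr_ge0 //; lra.
    have [->|vx'] := eqVneq v x'; last by rewrite Dv.
    by rewrite Dx' addr_ge0 // mulr_ge0 //; lra.
  + by rewrite Dsum.
  + by move=> v /supp[/yA//|[-> _]]; rewrite in_setU1 x'A orbT.
  + move=> u v /supp[yu|[-> yu]] /supp[yv|[-> yv]] //; first exact: yr.
      by rewrite rsym; exact: adj.
    exact: adj.
apply: (@contractible_in_deformation _ _ _ _ D).
- exact/clique_pts_sub/finset.subsetUr.
- exact: DB.
- by move=> y _; apply/funext => v; rewrite /D; ring.
- move=> y By; apply: (@clique_pts_setU1 _ x); last by rewrite Dx subrr mul0r.
  by apply: DB => //; lra.
move=> T F FF s f t y _ _ _ _ st fy v.
by apply: cvgD => //; apply: cvgM => //; apply: cvgM => //; exact: cvg_cst.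
Qed.


(* A point [y] of the complex on [x |: A] is moved into the complex on [A] by
   giving the mass of [x] to the face of [y] in [N], which is at the same time
   contracted, and is fully contracted once [x] has at least half of the mass
   of [x |: N]; the remaining vertices of [y] are adjacent to all of [N]. *)
Lemma contractible_weak_point A N x :
  x \notin A -> N \subset A ->
  (forall u, u \in A -> r x u -> u \notin N -> forall n, n \in N -> r u n) ->
  contractible_in (clique_pts N) -> contractible_in (clique_pts (x |: A)%SET) ->
  contractible_in (clique_pts A).
Proof.
move=> xA NA xr [n0 [c [n0N cN c0 c1 cc]]].
pose a y : R := \sum_(n in N) y n.
pose w y : R := Num.min 1 (2 * y x / (a y + y x)).
pose nrm y v : R := if v \in N then y v / a y else 0.
pose q y := if a y == 0 then n0 else c (w y) (nrm y).
pose rest y v : R := if (v == x) || (v \in N) then 0 else y v.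
pose rho y v : R := rest y v + (a y + y x) * q y v.
have xN : x \notin N by apply: contra xA; exact: (fintype.subsetP NA).
have a_ge0 y : clique_pts (x |: A)%SET y -> 0 <= a y.
  by case=> y0 _ _ _; apply: sumr_ge0.
have w01 y : clique_pts (x |: A)%SET y -> 0 <= w y <= 1.
  move=> By; have [y0 _ _ _] := By; have a0 := a_ge0 _ By.
  have : 0 <= 2 * y x / (a y + y x).
    by rewrite divr_ge0 ?mulr_ge0 ?addr_ge0.
  by rewrite /w; case: (leP 1 (2 * y x / (a y + y x))) => ? ?; lra.
have nrmN y : clique_pts (x |: A)%SET y -> a y != 0 -> clique_pts N (nrm y).
  move=> By ay0; have [y0 _ _ yr] := By.
  have supp v : nrm y v != 0 -> v \in N /\ y v != 0.
    rewrite /nrm; case: ifP => [vN|_]; last by rewrite eqxx.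
    by rewrite mulf_eq0 negb_or => /andP[].
  split=> [v|||].
  + by rewrite /nrm; case: ifP => // _; rewrite divr_ge0 // a_ge0.
  + by rewrite /nrm -big_mkcond -mulr_suml divff.
  + by move=> v /supp[].
  + by move=> u v /supp[_ yu] /supp[_ yv]; exact: yr.
have qN y : clique_pts (x |: A)%SET y -> clique_pts N (q y).
  move=> By; rewrite /q; case: eqP => // /eqP ay0.
  by apply: cN; [exact: w01|exact: nrmN].
have q_out y v : clique_pts (x |: A)%SET y -> v \notin N -> q y v = 0.
  move=> /qN[_ _ qN' _] vN; apply/eqP; apply: contraNT vN; exact: qN'.
have rho_id y : clique_pts (x |: A)%SET y -> y x = 0 -> rho y = y.
  move=> By yx; apply/funext => v; have [y0 _ _ _] := By.
  rewrite /rho /rest yx addr0; have [->|vx] /= := eqVneq v x.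
    by rewrite q_out // yx; ring.
  case: ifP => [vN|/negbT vN]; last by rewrite q_out //; ring.
  rewrite /q; have [ay|ay] := eqVneq (a y) 0.
    rewrite ay mul0r addr0; apply/esym.
    exact: (psumr_eq0P (fun n _ => y0 n) ay).
  have -> : w y = 0 by rewrite /w yx mulr0 mul0r; case: (leP 1 (0 : R)) => ?; lra.
  rewrite c0; last exact: nrmN.
  by rewrite /nrm vN; field.
apply: (@contractible_in_retract _ _ _ _ rho).
- exact/clique_pts_sub/finset.subsetUr.
- move=> y By; have [yx|yx] := eqVneq (y x) 0.
    by rewrite rho_id //; exact: clique_pts_setU1 By yx.
  have [y0 y1 yA yr] := By; have [q0 q1 qA qr] := qN _ By.
  have supp v : rho y v != 0 ->
      [/\ v \in A, y v != 0 & v \notin N] \/ v \in N /\ q y v != 0.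
    rewrite /rho /rest; case: ifP => [vxN|/negbT].
      rewrite add0r mulf_eq0 negb_or => /andP[_ qv].
      by right; split=> //; exact: qA.
    rewrite negb_or => /andP[vx vN]; rewrite q_out // mulr0 addr0 => yv.
    by left; split=> //; have := yA _ yv; rewrite in_setU1 (negPf vx).
  split=> [v|||].
  + have ay := a_ge0 _ By.
    by rewrite addr_ge0 ?mulr_ge0 ?addr_ge0 // /rest; case: ifP.
  + rewrite /rho big_split /= -mulr_sumr q1 mulr1 -y1 /rest.
    have -> : \sum_v (if (v == x) || (v \in N) then 0 else y v) =
              \sum_(v | (v != x) && (v \notin N)) y v.
      rewrite [RHS]big_mkcond; apply: eq_bigr => v _.
      by rewrite -negb_or; case: ifP.
    have -> : a y = \sum_(v | (v != x) && (v \in N)) y v.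
      apply: eq_bigl => v; have [->|//] := eqVneq v x.
      by rewrite (negPf xN).
    rewrite [in RHS](bigD1 x) //= [in RHS](bigID (mem N)) /=; ring.
  + by move=> v /supp[[]//|[vN _]]; exact: (fintype.subsetP NA).
  + move=> u v /supp[[uA yu uN]|[uN qu]] /supp[[vA yv vN]|[vN qv]].
    * exact: yr.
    * by apply: xr => //; exact: yr.
    * by rewrite rsym; apply: xr => //; exact: yr.
    * exact: qr.
- by move=> y Ay; apply: rho_id;
    [exact: (clique_pts_sub (finset.subsetUr _ _))|
     apply/eqP; apply: contraNT xA; case: Ay => _ _ yA _; exact: yA].
move=> T F FF f y By fB fy v; rewrite /rho.
apply: cvgD; first by rewrite /rest; case: ifP => // _; exact: cvg_cst.
have fa : a (f t) @[t --> F] --> a y.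
  by apply: cvg_big => [|n _]; [exact: add_continuous|exact: fy].
have fs : a (f t) + f t x @[t --> F] --> a y + y x by apply: cvgD.
have [y0 _ _ _] := By.
have ay0 := a_ge0 _ By.
(* The normalisation in [q] may have no limit where [a y = 0]. If [y x] is positive there, then [w]
   is 1 nearby and [q] is constantly [n0]; if [y x] is also 0, the bounded [q] is killed by the
   factor [a y + y x]. *)
have [ay|ay] := eqVneq (a y) 0; last first.
  have fa0 : \forall t \near F, a (f t) != 0.
    have : \forall t \near F, 0 < a (f t) by apply: (cvgr_gt _ fa); rewrite lt_neqAle eq_sym ay.
    by apply: filterS => t /gt_eqF ->.
  apply: cvgM => //.
  have -> : q y = c (w y) (nrm y) by rewrite /q (negPf ay).
  apply: (@cvg_trans _ (c (w (f t)) (nrm (f t)) v @[t --> F])).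
    by apply: near_eq_cvg; apply: filterS fa0 => t at0; rewrite /q (negPf at0).
  apply: cc.
  + exact: w01.
  + exact: nrmN.
  + by apply: filterS fB => t; exact: w01.
  + by apply: filterS2 fB fa0 => t; exact: nrmN.
  + apply: cvg_min; first exact: cvg_cst.
    apply: cvgM; first by apply: cvgM => //; exact: cvg_cst.
    apply: cvgV => //; apply: lt0r_neq0.
    by rewrite ltr_pwDl // lt_neqAle eq_sym ay.
  + move=> u; rewrite /nrm; case: ifP => _; last exact: cvg_cst.
    by apply: cvgM => //; apply: cvgV.
have [yx|yx] := eqVneq (y x) 0; last first.
  apply: cvgM => //.
  have -> : q y = n0 by rewrite /q ay eqxx.
  apply: (@cvg_trans _ (n0 v @[t --> F])); last exact: cvg_cst.
  apply: near_eq_cvg.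
  have fsa : f t x - a (f t) @[t --> F] --> y x - a y by apply: cvgB.
  have : \forall t \near F, 0 < f t x - a (f t).
    by apply: (cvgr_gt _ fsa); rewrite ay subr0 lt_neqAle eq_sym yx y0.
  move=> near_gt; near=> t.
  have Bt : clique_pts (x |: A)%SET (f t) by near: t.
  have gt0 : 0 < f t x - a (f t) by near: t.
  have at0 := a_ge0 _ Bt.
  rewrite /q; case: eqP => // /eqP at0'.
  have -> : w (f t) = 1.
    rewrite /w; apply/min_idPl; rewrite ler_pdivlMr; last by lra.
    by lra.
  by rewrite c1 //; exact: nrmN.
rewrite ay yx addr0 mul0r.
apply: (@squeeze_cvgr _ _ _ _ (fun=> 0) (fun t => a (f t) + f t x)); last 2 first.
- exact: cvg_cst.
- by rewrite ay yx addr0 in fs.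
apply: filterS fB => t Bt; have at0 := a_ge0 _ Bt; have [t0 _ _ _] := Bt.
have tx := t0 x.
have [q0 _ _ _] := qN _ Bt; have q1 := clique_pts_le1 v (qN _ Bt).
by rewrite mulr_ge0 ?addr_ge0 //= ler_piMr // addr_ge0.
Unshelve. all: by end_near. Qed.

End CliqueComplex.

(** * From coordinates to the topological realization *)

Section Realization.
Local Open Scope classical_set_scope.
Local Open Scope ring_scope.

(** By injectivity of [phi], [push] is extension by zero, and [pull] undoes it; conjugating by them
    transports the homotopy. *)
Lemma contractible_in_reindex (R : realType) (V W : finType) (rV : rel V)
    (rW : rel W) (A : {set V}) (phi : W -> V) :
  (forall u v, rW u v = rV (phi u) (phi v)) -> injective phi ->
  (forall v, v \in A = [exists u, v == phi u]) ->
  contractible_in (@clique_pts R V rV A) ->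
  contractible_in (@clique_pts R W rW [set: W]%SET).
Proof.
move=> r_phi phi_inj A_phi [a [H [Aa HA H0 H1 Hc]]].
pose pull (z : V -> R) w := z (phi w).
pose push (y : W -> R) v := \sum_(w | phi w == v) y w.
have phiA w : phi w \in A by rewrite A_phi; apply/existsP; exists w.
have pushE y w : push y (phi w) = y w.
  by rewrite /push (big_pred1 w) // => u; rewrite /= (inj_eq phi_inj).
have push_supp y v : push y v != 0 -> exists2 w, v = phi w & y w != 0.
  move=> yv; have [vA|vA] := boolP (v \in A).
    move: vA yv; rewrite A_phi => /existsP[w /eqP ->]; rewrite pushE.
    by exists w.
  move: yv; rewrite /push big_pred0 ?eqxx // => w; apply: contraNF vA => /eqP <-.
  exact: phiA.
have pullK y : pull (push y) = y by apply/funext => w; rewrite /pull pushE.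
have push_pts y : clique_pts rW [set: W]%SET y -> clique_pts rV A (push y).
  move=> [y0 y1 _ yr]; split.
  + by move=> v; apply: sumr_ge0.
  + by rewrite -y1 [RHS](partition_big phi xpredT).
  + by move=> v /push_supp[w ->].
  + by move=> u v /push_supp[w -> yw] /push_supp[w' -> yw']; rewrite -r_phi yr.
have pull_pts z : clique_pts rV A z -> clique_pts rW [set: W]%SET (pull z).
  move=> [z0 z1 zA zr]; split=> [||w _|u w zu zw].
  + by move=> v; exact: z0.
  + rewrite -z1 (partition_big phi xpredT) //=; apply: eq_bigr => v _.
    have [vA|vA] := boolP (v \in A).
      move: vA; rewrite A_phi => /existsP[w /eqP ->].
      by rewrite (big_pred1 w) // => u; rewrite /= (inj_eq phi_inj).
    rewrite big_pred0; first by apply/esym/eqP; apply: contraNT vA; exact: zA.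
    by move=> w; apply: contraNF vA => /eqP <-.
  + by rewrite inE.
  + by rewrite r_phi; exact: zr.
exists (pull a), (fun t y => pull (H t (push y))); split.
- exact: pull_pts.
- by move=> t y t01 Wy; apply/pull_pts/HA => //; exact: push_pts.
- by move=> y Wy; rewrite H0 ?pullK //; exact: push_pts.
- by move=> y Wy; rewrite H1 //; exact: push_pts.
move=> T F FF s f t y t01 Wy s01 fW st fy w; apply: Hc => //.
- exact: push_pts.
- by apply: filterS fW => u; exact: push_pts.
- by move=> v; apply: cvg_big => [|u _]; [exact: add_continuous|exact: fy].
Qed.

Lemma ptws_cvg (R : realType) (V : finType) (F : set_system {ptws V -> R})
    (FF : Filter F) (y : {ptws V -> R}) :
  (forall v, f v @[f --> F] --> y v) -> F --> y.
Proof.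
move=> Fy; apply/cvg_sup => v U [_ [[W oW <-] /= Wy WU]].
rewrite nbhs_filterE; apply: (@filterS _ F FF _ _ WU).
exact: (Fy v W (open_nbhs_nbhs (conj oW Wy))).
Qed.

Lemma contractible_realization (R : realType) (V : finType)
    (K : {set {set V}}) :
  contractible_in (@realization_set R V K) -> contractible R (realization R K).
Proof.
move=> [a [H [Ka HK H0 H1 Hc]]].
have val_set (x : realization R K) : realization_set K (set_val x).
  exact: set_valP.
(* At times outside the unit interval [H] may leave the set; the default [p.2] is harmless there, as
   continuity is only required within the interval. *)
pose h (p : R * realization R K) : realization R K :=
  if pselect (realization_set K (H p.1 (set_val p.2))) is left Kp
  then SigSub (mem_set Kp) else p.2.
have hE p : 0 <= p.1 <= 1 -> set_val (h p) = H p.1 (set_val p.2).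
  move=> p01; rewrite /h; case: pselect => [//|[]]; apply: HK => //.
exists (SigSub (mem_set Ka)), h; split.
- apply/subspace_continuousP => -[t x] [/= t01 _].
  have {}t01 : 0 <= t <= 1 by move: t01; rewrite in_itv.
  move=> U [_ [[W oW <-] /= Wx WU]].
  rewrite nbhs_filterE; apply: (filterS WU).
  set D := `[0, 1] `*` setT; set G := within D (nbhs (t, x)).
  have GG : Filter G by exact: within_filter.
  have in01 : \forall p \near G, 0 <= p.1 <= 1.
    apply: (@filterS _ G GG D); last exact: withinT.
    by move=> -[u z] [/= + _]; rewrite in_itv.
  have G1 : p.1 @[p --> G] --> t.
    apply: cvg_trans; last exact: (@cvg_fst _ _ (nbhs t) (nbhs x)).
    exact: cvg_app (@cvg_within _ _ _ _).
  have G2 : p.2 @[p --> G] --> x.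
    apply: cvg_trans; last exact: (@cvg_snd _ _ (nbhs t) (nbhs x)).
    exact: cvg_app (@cvg_within _ _ _ _).
  have Gv u : set_val p.2 u @[p --> G] --> set_val x u.
    have valx : set_val z @[z --> x] --> (set_val x : {ptws V -> R}).
      exact: initial_continuous.
    exact: cvg_comp (cvg_comp _ _ G2 valx) (@proj_continuous _ _ u _).
  have cvgh : set_val (h p) @[p --> G] --> (set_val (h (t, x)) : {ptws V -> R}).
    apply: ptws_cvg => v; rewrite hE //.
    apply: (@cvg_trans _ (H p.1 (set_val p.2) v @[p --> G])).
      apply: (@near_eq_cvg _ _ G GG); apply: filterS in01 => p p01.
      by rewrite /= hE.
    apply: Hc => //.
    by apply: nearW => p; exact: val_set.
  exact: (cvgh W (open_nbhs_nbhs (conj oW Wx))).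
- move=> x; apply: val_inj; rewrite -!set_valE hE /= ?H0 //.
  by rewrite lexx ler01.
- move=> x; apply: val_inj; rewrite -!set_valE hE /= ?H1 //.
  by rewrite lexx ler01.
Qed.

End Realization.

(** * COMs seen from a base tope *)

Section Reorientation.
Context (E : finType) (B : signvec E).
Hypothesis B_tope : nowhere_zero B.
Implicit Types (L : {set signvec E}) (A P S F : {set E}).

(** The decoding of a set [P]: the sign vector separated from [B] exactly on [P]. *)
Definition reorient P : signvec E :=
  [ffun e => if e \in P then sign_opp (B e) else B e].

(** The family $C_S$. Keeping [S] as a parameter makes every upper fibre met in the induction a
    family of the same form. *)
Definition tope_sets L S : {set {set E}} :=
  [set P : {set E} | S \subset P & reorient P \in L]%SET.

(** Face symmetry is used twice: where [X] vanishes, the two sign changes of [Y] cancel. *)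
Lemma sv_comp_COM L X Y :
  is_COM L -> X \in L -> Y \in L -> sv_comp X Y \in L.
Proof.
move=> [FS _] XL YL.
suff -> : sv_comp X Y = sv_comp X (sv_opp (sv_comp X (sv_opp Y))).
  by apply: (FS) => //; exact: FS.
by apply/ffunP => e; rewrite !ffunE; case: (X e) (Y e) => [] [].
Qed.

Lemma base_neq0 e : B e != Zero.
Proof. exact: (forallP B_tope). Qed.

(* Eliminating the elements of [F] one at a time between the topes [e |: S]
   pushes one of them down to the cell whose composition with [-B] is
   [S :|: F]. *)
Lemma join_mem L S F : is_COM L -> B \in L ->
  reorient S \notin L -> [disjoint S & F] -> F != finset.set0 ->
  (forall e, e \in F -> reorient (e |: S)%SET \in L) ->
  reorient (S :|: F)%SET \in L.
Proof.
move=> LCOM BL SL dSF /set0Pn[e0 e0F] atoms.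
pose cell A P : signvec E := [ffun f => if f \in A then Zero else reorient P f].
have cells A : A \subset F -> forall e, e \in (F :\: A)%SET ->
    cell A (e |: S)%SET \in L.
  have [n] := ubnP #|A|; elim: n A => // n IH A ltA AF e; rewrite inE => /andP[eA eF].
  have [->|/set0Pn[a aA]] := eqVneq A finset.set0.
    suff -> : cell finset.set0 (e |: S)%SET = reorient (e |: S)%SET by exact: atoms.
    by apply/ffunP => f; rewrite !ffunE inE.
  have aF : a \in F by exact: (fintype.subsetP AF).
  have ae : a != e by apply: contraNneq eA => <-.
  have A'F : (A :\ a)%SET \subset F by apply: fintype.subset_trans AF; exact: subD1set.
  have {}ltA : (#|(A :\ a)%SET| < n)%N by rewrite (cardsD1 a) aA in ltA.
  have Xa := IH _ ltA A'F a; have Xe := IH _ ltA A'F e.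
  have {}Xa : cell (A :\ a)%SET (a |: S)%SET \in L by apply: Xa; rewrite !inE eqxx aF.
  have {}Xe : cell (A :\ a)%SET (e |: S)%SET \in L.
    by apply: Xe; rewrite !inE eF (negPf eA) andbF.
  have notS f : f \in F -> f \notin S.
    by move=> fF; apply: contraTN fF => fS; rewrite (disjointFr dSF fS).
  have asep : a \in separator (cell (A :\ a)%SET (a |: S)%SET)
                              (cell (A :\ a)%SET (e |: S)%SET).
    rewrite !inE !ffunE !inE eqxx /= (negPf ae) (negPf (notS _ aF)) eqxx /=.
    by have := base_neq0 a; case: (B a).
  have [Z [ZL Za Zf]] := LCOM.2 _ _ Xa Xe a asep.
  have Zf' f : f != a -> f != e -> Z f = cell A S f.
    move=> fa fe; rewrite Zf.
      rewrite !ffunE !inE (negPf fa) (negPf fe) /=.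
      by case: (f \in A); case: (f \in S); have := base_neq0 f; case: (B f).
    rewrite !inE !ffunE !inE (negPf fa) (negPf fe) /=.
    by case: (f \in A); case: (f \in S); have := base_neq0 f; case: (B f).
  (* Outside [e], [Z] is already the wanted cell. If its sign at [e] is not that of [-B], then
     composing with [B] fills all the zeros and yields [reorient S], which is excluded. *)
  have [Ze|Ze] := eqVneq (Z e) (sign_opp (B e)).
    suff -> : cell A (e |: S)%SET = Z by [].
    apply/ffunP => f; have [->|fa] := eqVneq f a; first by rewrite Za ffunE aA.
    have [->|fe] := eqVneq f e.
      by rewrite Ze !ffunE (negPf eA) !inE eqxx.
    by rewrite Zf' // !ffunE !inE (negPf fe).
  case/negP: SL; suff -> : reorient S = sv_comp Z B by exact: sv_comp_COM.
  apply/ffunP => f; have [->|fa] := eqVneq f a.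
    by rewrite !ffunE Za /= (negPf (notS _ aF)).
  have [->|fe] := eqVneq f e.
    rewrite !ffunE (negPf (notS _ eF)).
    by move: Ze (base_neq0 e); case: (Z e) (B e) => [] [].
  rewrite [RHS]ffunE Zf' // !ffunE; case: (boolP (f \in A)) => fA.
    by rewrite (negPf (notS _ (fintype.subsetP AF _ fA))).
  by have := base_neq0 f; case: (f \in S); case: (B f).
have := cells (F :\ e0)%SET (subD1set _ _) e0; rewrite !inE eqxx e0F => /(_ isT) XL.
suff -> : reorient (S :|: F)%SET =
          sv_comp (cell (F :\ e0)%SET (e0 |: S)%SET) (sv_opp B) by exact: LCOM.1.
apply/ffunP => f; rewrite !ffunE !inE.
have [->|_] /= := eqVneq f e0.
  by rewrite e0F orbT; have := base_neq0 e0; case: (B e0).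
by case: (f \in F); case: (f \in S); have := base_neq0 f; case: (B f).
Qed.

(** Deletion of [e], encoded by fixing the coordinate at the sign of [B] instead of removing it, so
    that the ground set does not change along the induction. *)
Definition forget e L : {set signvec E} :=
  [set [ffun f => if f == e then B f else X f] | X : signvec E in L]%SET.

Lemma forget_COM e L : is_COM L -> is_COM (forget e L).
Proof.
move=> [FS SE]; split.
  move=> _ _ /imsetP[X XL ->] /imsetP[Y YL ->].
  apply/imsetP; exists (sv_comp X (sv_opp Y)); first exact: FS.
  apply/ffunP => f; rewrite !ffunE; case: (f =P e) => // _.
  by have := base_neq0 f; case: (B f).
move=> _ _ /imsetP[X XL ->] /imsetP[Y YL ->] g.
rewrite !inE !ffunE; have [->|ge] := eqVneq g e.
  by have := base_neq0 e; case: (B e).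
move=> gXY; have [|Z [ZL Zg Zf]] := SE _ _ XL YL g; first by rewrite inE.
exists [ffun f => if f == e then B f else Z f]; split.
- by apply/imsetP; exists Z.
- by rewrite ffunE (negPf ge).
move=> f; rewrite !inE !ffunE; have [->|fe] := eqVneq f e; first by rewrite base_neq0.
by move=> fXY; rewrite Zf ?ffunE // inE.
Qed.

(** Lifting a tope of the deletion is the point: its preimage [X] may vanish at [e], but then
    composing [X] with [B] gives a tope of [L]. *)
Lemma tope_sets_forget e L S : is_COM L -> B \in L -> e \notin S ->
  tope_sets (forget e L) S = [set (P :\ e)%SET | P in tope_sets L S]%SET.
Proof.
move=> LCOM BL eS; apply/setP => P; rewrite inE; apply/andP/imsetP; last first.
  case=> Q; rewrite inE => /andP[SQ QL] ->; split.
    by rewrite subsetD1 SQ eS.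
  apply/imsetP; exists (reorient Q) => //; apply/ffunP => f; rewrite !ffunE !inE.
  by case: eqP.
case=> SP /imsetP[X XL eX].
have PX f : f != e -> X f = reorient P f by move=> fe; rewrite eX ffunE (negPf fe).
have eP : e \notin P.
  have := congr1 (fun Z : signvec E => Z e) eX; rewrite !ffunE eqxx; case: ifP => // _.
  by have := base_neq0 e; case: (B e).
have [Xe|Xe] := eqVneq (X e) (sign_opp (B e)).
  exists (e |: P)%SET; last by rewrite setU1K.
  rewrite inE (fintype.subset_trans SP (finset.subsetUr _ _)) /=.
  suff -> : reorient (e |: P)%SET = X by [].
  apply/ffunP => f; have [->|fe] := eqVneq f e; first by rewrite ffunE !inE eqxx Xe.
  by rewrite PX // !ffunE !inE (negPf fe).
exists P; last first.
  by apply/setP => f; rewrite !inE; case: eqP => // ->; rewrite (negPf eP).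
rewrite inE SP /=; suff -> : reorient P = sv_comp X B by exact: sv_comp_COM.
apply/ffunP => f; rewrite [RHS]ffunE; have [->|fe] := eqVneq f e.
  rewrite ffunE (negPf eP).
  by move: Xe (base_neq0 e); case: (X e) (B e) => [] [].
rewrite PX // ffunE; have := base_neq0 f.
by case: (f \in P); case: (B f).
Qed.

End Reorientation.

(** * Families of sets ordered by inclusion, up to Quillen's fibre lemma *)

Section InclusionComplex.
Context (R : realType) (E : finType).
Implicit Types (C D U : {set {set E}}) (P Q : {set E}).

Definition nested : rel {set E} := fun P Q => (P \subset Q) || (Q \subset P).

Lemma nested_refl : reflexive nested.
Proof. by move=> P; rewrite /nested fintype.subxx. Qed.

Lemma nested_sym : symmetric nested.
Proof. by move=> P Q; rewrite /nested orbC. Qed.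

Definition chain_contractible C : Prop :=
  contractible_in (@clique_pts R _ nested C).

Lemma chain_contractible_min C P :
  P \in C -> (forall Q, Q \in C -> P \subset Q) -> chain_contractible C.
Proof.
move=> PC Pmin; apply: (@contractible_cone R _ _ nested_refl nested_sym C P PC) => Q /Pmin PQ.
by rewrite /nested PQ.
Qed.

Lemma chain_contractible_max C P :
  P \in C -> (forall Q, Q \in C -> Q \subset P) -> chain_contractible C.
Proof.
move=> PC Pmax; apply: (@contractible_cone R _ _ nested_refl nested_sym C P PC) => Q /Pmax QP.
by rewrite /nested QP orbT.
Qed.

(** Larger sets of [U] are added first. When [P] arrives, the sets present and properly inside it
    belong to [D], so they miss [e] and lie in [P :\ e]: [P] is a beat point. *)
Lemma chain_contractible_add D U e :
  (forall P, P \in D -> e \notin P) ->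
  (forall P, P \in U -> e \in P /\ (P :\ e)%SET \in D) ->
  chain_contractible D -> chain_contractible (D :|: U)%SET.
Proof.
move=> De; have [n] := ubnP #|U|; elim: n U => // n IH U ltU Ue Dc.
have [->|/set0Pn[P0 P0U]] := eqVneq U finset.set0; first by rewrite finset.setU0.
have [P /= PU Pmin] := @arg_minnP _ P0 [in U] (fun P => #|P|) P0U.
have [eP PD] := Ue _ PU.
have -> : (D :|: U)%SET = (P |: (D :|: U :\ P))%SET.
  by apply/setP => Q; rewrite !inE; have [->|//] := eqVneq Q P; rewrite PU orbT.
apply: (@contractible_beat_point R _ _ nested_refl nested_sym _ _ (P :\ e)%SET).
- by rewrite !inE eqxx /= orbF; apply/negP => /De; rewrite eP.
- by rewrite !inE PD.
- by rewrite /nested subD1set orbT.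
- move=> Q QDU /orP[PQ|QP].
    by rewrite /nested (fintype.subset_trans (subD1set _ _) PQ).
  rewrite /nested subsetD1 QP /=; move: QDU; rewrite !inE.
  case/orP=> [/De ->|/andP[QP' QU]]; first by rewrite orbT.
  case/negP: QP'; rewrite finset.eqEcard QP /=.
  exact: Pmin.
- apply: IH => //.
    by rewrite (cardsD1 P) PU in ltU.
  by move=> Q; rewrite inE => /andP[_ /Ue].
Qed.

(** Larger sets of [U] are removed first. When [P] goes, the sets above it all belong to [C], and
    its other neighbours lie below it, hence are nested with those above: [P] is a weak point. *)
Lemma chain_contractible_remove C U :
  (forall P, P \in U -> P \notin C) ->
  (forall P, P \in U -> chain_contractible [set Q in C | P \subset Q]%SET) ->
  chain_contractible (C :|: U)%SET -> chain_contractible C.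
Proof.
have [n] := ubnP #|U|; elim: n U => // n IH U ltU UC Uc.
have [->|/set0Pn[P0 P0U]] := eqVneq U finset.set0; first by rewrite finset.setU0.
have [P /= PU Pmax] := @arg_maxnP _ P0 [in U] (fun P => #|P|) P0U.
have -> : (C :|: U)%SET = (P |: (C :|: U :\ P))%SET.
  by apply/setP => Q; rewrite !inE; have [->|//] := eqVneq Q P; rewrite PU orbT.
move=> CUc; apply: (IH (U :\ P)%SET).
- by rewrite (cardsD1 P) PU in ltU.
- by move=> Q; rewrite inE => /andP[_ /UC].
- by move=> Q; rewrite inE => /andP[_ /Uc].
apply: (@contractible_weak_point R _ _ nested_sym _ _ P _ _ _ (Uc _ PU) CUc).
- by rewrite !inE eqxx /= orbF; exact: UC.
- by apply/fintype.subsetP => Q; rewrite !inE => /andP[->].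
move=> Q QCU + + N; rewrite !inE => /orP[PQ|QP] QN /andP[NC PN].
  case/negP: QN; rewrite PQ andbT; move: QCU; rewrite !inE.
  case/orP=> // /andP[QP QU]; case/negP: QP.
  by rewrite eq_sym finset.eqEcard PQ /=; exact: Pmax.
by rewrite /nested (fintype.subset_trans QP PN).
Qed.

(* Quillen's fibre lemma for the map [P |-> P :\ e]. *)
Lemma chain_contractible_fibre C e :
  chain_contractible [set (P :\ e)%SET | P in C]%SET ->
  (forall P, P \in C ->
    chain_contractible [set Q in C | (P :\ e)%SET \subset Q]%SET) ->
  chain_contractible C.
Proof.
set D := [set _ | _ in C]%SET => Dc Cc.
apply: (@chain_contractible_remove C (D :\: C)%SET).
- by move=> P; rewrite inE => /andP[].
- by move=> Q; rewrite inE => /andP[_ /imsetP[P PC ->]]; exact: Cc.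
(* Members of [C] that avoid [e] are their own images, so [C] with the missing images is also the
   image with the members containing [e]. *)
have -> : (C :|: D :\: C)%SET = (D :|: [set P in C | e \in P])%SET.
  apply/setP => P; rewrite !inE; have [PC|PC] /= := boolP (P \in C); last by rewrite orbF.
  apply/esym/orP; have [eP|eP] := boolP (e \in P); first by right.
  left; apply/imsetP; exists P => //.
  by apply/setP => f; rewrite !inE; case: eqP => // ->; rewrite (negPf eP).
apply: (@chain_contractible_add _ _ e) => //.
  by move=> _ /imsetP[P _ ->]; rewrite !inE eqxx.
by move=> P; rewrite inE => /andP[PC eP]; split=> //; exact: imset_f.
Qed.

End InclusionComplex.

(** [S :|: F] contains every coordinate where a covector may differ from [B], so it bounds the whole
    family. Deletion shrinks [F] and passing to an upper fibre enlarges [S]; both lower the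
    cardinality of [F :\: S]. *)
Lemma tope_sets_contractible (R : realType) (E : finType) (B : signvec E)
    (L : {set signvec E}) (S F : {set E}) :
  nowhere_zero B -> is_COM L -> B \in L ->
  (forall X e, X \in L -> e \notin (S :|: F)%SET -> X e = B e) ->
  tope_sets B L S != finset.set0 -> chain_contractible R (tope_sets B L S).
Proof.
move=> B0; have [n] := ubnP #|(F :\: S)%SET|.
elim: n L S F => // n IH L S F ltF LCOM BL LB T0.
have bound P : P \in tope_sets B L S -> P \subset (S :|: F)%SET.
  rewrite inE => /andP[_ PL]; apply/fintype.subsetP => e; apply: contraLR => eSF.
  have := LB _ _ PL eSF; rewrite ffunE; case: ifP => // _.
  by have := base_neq0 B0 e; case: (B e).
have [SL|SL] := boolP (reorient B S \in L).
  apply: (@chain_contractible_min _ _ _ S); first by rewrite inE fintype.subxx.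
  by move=> P; rewrite inE => /andP[].
have [SFL|SFL] := boolP (reorient B (S :|: F)%SET \in L).
  apply: (@chain_contractible_max _ _ _ (S :|: F)%SET _ bound).
  by rewrite inE finset.subsetUl.
have FS0 : (F :\: S)%SET != finset.set0.
  apply: contraNneq SL => FS0; have [P PT] := set0Pn _ T0.
  suff -> : S = P by move: PT; rewrite inE => /andP[].
  have := PT; rewrite inE => /andP[SP _]; have PSF := bound _ PT.
  apply/eqP; rewrite finset.eqEsubset SP /=; apply: fintype.subset_trans PSF _.
  by rewrite finset.subUset fintype.subxx -finset.setD_eq0 FS0 eqxx.
have [e eF eL] : exists2 e, e \in (F :\: S)%SET & reorient B (e |: S)%SET \notin L.
  apply/exists_inP; rewrite -negb_forall_in; apply: contra SFL => /forall_inP atoms.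
  have -> : (S :|: F)%SET = (S :|: F :\: S)%SET.
    by apply/setP => f; rewrite !inE; case: (f \in S).
  apply: join_mem => //.
  by rewrite disjoint_sym -finset.setI_eq0 finset.setDE -finset.setIA [X in (_ :&: X)%SET]finset.setIC finset.setICr finset.setI0.
have [eNS eFF] : e \notin S /\ e \in F by move: eF; rewrite inE => /andP[].
apply: (@chain_contractible_fibre _ _ _ e).
  rewrite -tope_sets_forget //; apply: (IH _ S (F :\ e)%SET).
  - have -> : ((F :\ e) :\: S)%SET = ((F :\: S) :\ e)%SET.
      by apply/setP => f; rewrite !inE andbCA.
    by rewrite (cardsD1 e) eF in ltF.
  - exact: forget_COM.
  - by apply/imsetP; exists B => //; apply/ffunP => f; rewrite ffunE if_same.
  - move=> _ f /imsetP[X XL ->]; rewrite ffunE !inE; case: (f =P e) => //= _ fSF.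
    by apply: LB => //; rewrite inE.
  - by rewrite tope_sets_forget // imset_eq0.
move=> P PT; have := PT; rewrite inE => /andP[SP PL].
have SPe : S \subset (P :\ e)%SET by rewrite subsetD1 SP.
have -> : [set Q in tope_sets B L S | (P :\ e)%SET \subset Q]%SET =
          tope_sets B L (P :\ e)%SET.
  apply/setP => Q; rewrite !inE andbC andbA; congr andb.
  by apply/andP/idP => [[]//|PQ]; split=> //; exact: fintype.subset_trans PQ.
have PeF : (P :\ e)%SET \subset (S :|: F)%SET.
  by apply: fintype.subset_trans (bound _ PT); exact: subD1set.
apply: (IH _ _ F) => //.
(* Were [P :\ e] equal to [S], then [P] would be [S] or [e |: S], and neither is a tope set. *)
- suff [f fP fS] : exists2 f, f \in (P :\ e)%SET & f \notin S.
    rewrite -ltnS; apply: leq_trans ltF; rewrite ltnS; apply: proper_card.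
    apply/properP; split.
      by apply: finset.setDS.
    exists f; last by rewrite inE fP.
    rewrite inE fS /=; have := fintype.subsetP PeF _ fP.
    by rewrite inE (negPf fS).
  apply/fintype.subsetPn; apply/negP => PeS.
  have PeE : (P :\ e)%SET = S by apply/eqP; rewrite finset.eqEsubset PeS.
  have [eP|eP] := boolP (e \in P).
    by case/negP: eL; rewrite -PeE finset.setD1K.
  case/negP: SL; rewrite -PeE; suff -> : (P :\ e)%SET = P by [].
  by apply/setP => f; rewrite !inE; case: eqP => // ->; rewrite (negPf eP).
- move=> X f XL; rewrite inE negb_or => /andP[fP fF]; apply: LB => //.
  by rewrite inE negb_or fF andbT; apply: contra fP; exact: fintype.subsetP.
- by apply/set0Pn; exists P; rewrite inE subD1set.
Qed.

(** * The topal fiber in terms of the base tope *)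

Section TopalFiber.
Context (E : finType) (L : {set signvec E}) (Sp Sm : {set E}) (B : signvec E).
Hypotheses (B_tope : nowhere_zero B) (dis : [disjoint Sp & Sm]).

Let A : {set E} := (~: (Sp :|: Sm))%SET.

(** The base tope need not have the prescribed signs. Where it has them they cut out a smaller COM;
    the other prescribed coordinates form the set that all members of the family must contain. *)
Definition base_agrees : {set E} :=
  [set e | (e \in Sp) && (B e == Pos) || (e \in Sm) && (B e == Neg)]%SET.

Definition base_fiber : {set signvec E} :=
  [set X in L | [forall e in base_agrees, X e == B e]]%SET.

Definition base_differs : {set E} := ((Sp :|: Sm) :\: base_agrees)%SET.

(** For a tope [Q] of the fiber this is the separator between [B] and the tope of [L] over [Q]: on
    prescribed coordinates it does not depend on [Q]. *)
Definition separator_lift (Q : signvec {e : E | e \in A}) : {set E} :=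
  (base_differs :|: [set val f | f in separator (sv_restrict A B) Q])%SET.

(** On [base_agrees] all vectors carry the same nonzero sign, so composition and elimination
    preserve it. *)
Lemma base_fiber_COM : is_COM L -> is_COM base_fiber.
Proof.
have fib X : X \in base_fiber -> X \in L /\ forall e, e \in base_agrees -> X e = B e.
  by rewrite inE => /andP[XL /forall_inP XB]; split=> // e /XB/eqP.
move=> [FS SE]; split=> X Y /fib[XL XB] /fib[YL YB].
  rewrite inE FS //=; apply/forall_inP => e eD; rewrite ffunE XB //.
  by rewrite base_neq0.
move=> e eXY; have [Z [ZL Ze Zf]] := SE X Y XL YL e eXY; exists Z; split=> //.
rewrite inE ZL; apply/forall_inP => f fD; rewrite Zf ?ffunE ?XB ?base_neq0 //.
rewrite inE XB ?YB //.
by have := base_neq0 B_tope f; case: (B f).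
Qed.

Lemma mem_separator_lift_in Q e (eA : e \in A) :
  (e \in separator_lift Q) = (exist _ e eA \in separator (sv_restrict A B) Q).
Proof.
rewrite inE (_ : e \in base_differs = false) /=; last first.
  by apply/negbTE; rewrite inE negb_and orbC -finset.in_setC eA.
by rewrite -(mem_imset _ _ val_inj).
Qed.

Lemma mem_separator_lift_out Q e :
  e \notin A -> (e \in separator_lift Q) = (e \in base_differs).
Proof.
move=> eA; rewrite inE; case: (e \in base_differs) => //=.
by apply/imsetP => -[[f fA] _ /= ef]; rewrite ef fA in eA.
Qed.

Lemma separator_lift_subset P Q :
  (separator_lift P \subset separator_lift Q) =
  (separator (sv_restrict A B) P \subset separator (sv_restrict A B) Q).
Proof.
apply/idP/idP => [/fintype.subsetP PQ|PQ].
  apply/fintype.subsetP => -[e eA]; rewrite -!mem_separator_lift_in.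
  exact: PQ.
by apply: finset.setUS; exact: imsetS.
Qed.

Lemma fiber_reorient (X : signvec E) :
  (forall e, e \in Sp -> X e = Pos) -> (forall e, e \in Sm -> X e = Neg) ->
  nowhere_zero (sv_restrict A X) ->
  reorient B (separator_lift (sv_restrict A X)) = X.
Proof.
move=> Xp Xm /forallP X0; apply/ffunP => e; rewrite ffunE.
have [eA|eA] := boolP (e \in A).
  rewrite mem_separator_lift_in inE !ffunE /=.
  have := X0 (exist _ e eA); rewrite ffunE /=.
  by have := base_neq0 B_tope e; case: (B e) (X e) => [] [].
rewrite mem_separator_lift_out //; move: eA; rewrite !inE negbK.
have := base_neq0 B_tope e.
have [ep|_] := boolP (e \in Sp).
  by rewrite (disjointFr dis ep) Xp //; case: (B e).
by move=> + /= em; rewrite em Xm //; case: (B e).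
Qed.

(** A tope has the prescribed signs exactly when its separator from [B] contains [base_differs] and
    misses [base_agrees]. [tope_sets] imposes the first condition and [base_fiber] the second. *)
Lemma tope_sets_fiber (P : {set E}) :
  (P \in tope_sets B base_fiber base_differs) =
  [exists Q in topes (topal_fiber Sp Sm L), P == separator_lift Q].
Proof.
apply/idP/exists_inP.
  rewrite inE => /andP[SP]; rewrite inE => /andP[PL /forall_inP PB].
  have PD e : e \in base_agrees -> e \notin P.
    move=> /PB; rewrite ffunE; case: ifP => // _.
    by have := base_neq0 B_tope e; case: (B e).
  have Pp e : e \in Sp -> reorient B P e = Pos.
    move=> ep; have := PD e; have := fintype.subsetP SP e.
    rewrite !inE ffunE ep (disjointFr dis ep) /=.
    have := base_neq0 B_tope e.
    case: (B e) (e \in P) => [] [] //= _ h1 h2.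
      by have := h2 isT.
    by have := h1 isT.
  have Pm e : e \in Sm -> reorient B P e = Neg.
    move=> em; have := PD e; have := fintype.subsetP SP e.
    rewrite !inE ffunE em (disjointFl dis em) /=.
    have := base_neq0 B_tope e.
    case: (B e) (e \in P) => [] [] //= _ h1 h2.
      by have := h1 isT.
    by have := h2 isT.
  have P0 : nowhere_zero (reorient B P).
    apply/forallP => e; rewrite ffunE; have := base_neq0 B_tope e.
    by case: ifP => _; case: (B e).
  have P0' : nowhere_zero (sv_restrict A (reorient B P)).
    by apply/forallP => e; rewrite ffunE; exact: forallP P0 _.
  exists (sv_restrict A (reorient B P)).
    rewrite inE P0' andbT; apply/imsetP; exists (reorient B P) => //.
    rewrite inE PL /=; apply/andP.
    by split; apply/forall_inP => e /[dup]; [move/Pp->|move/Pm->].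
  apply/eqP/setP => e.
  have /ffunP/(_ e) := fiber_reorient Pp Pm P0'.
  rewrite !ffunE; have := base_neq0 B_tope e.
  by case: (e \in P); case: (e \in separator_lift _); case: (B e).
case=> _ /[!inE] /andP[/imsetP[X + ->] X0] /eqP ->.
rewrite inE => /and3P[XL /forall_inP Xp /forall_inP Xm].
have {}Xp e : e \in Sp -> X e = Pos by move/Xp/eqP.
have {}Xm e : e \in Sm -> X e = Neg by move/Xm/eqP.
rewrite fiber_reorient // finset.subsetUl XL /=.
apply/forall_inP => e; rewrite inE => /orP[]/andP[eS /eqP->].
  by rewrite Xp.
by rewrite Xm.
Qed.

End TopalFiber.

Theorem theorem3p5 (K : realType) (E' : finType) (L' : {set signvec E'})
    (Sp Sm : {set E'})
    (R : sign_pattern {e : E' | e \in (~: (Sp :|: Sm))%SET}) :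
  is_COM L' ->
  [disjoint Sp & Sm] ->
  is_COM (topal_fiber Sp Sm L') ->
  topes (topal_fiber Sp Sm L') <> finset.set0 ->
  (exists2 R' : signvec E', R' \in topes L' &
     val R = sv_restrict (~: (Sp :|: Sm))%SET R') ->
  contractible K
    (realization K (order_complex (tope_poset (topal_fiber Sp Sm L') R))).
Proof.
move=> LCOM dis _ /eqP/set0Pn[Q0 Q0T] [B].
rewrite inE => /andP[BL B0] RB.
pose T := tope_poset (topal_fiber Sp Sm L') R.
apply: contractible_realization.
(* A chain is a set of pairwise comparable elements, so the order complex is a clique complex. *)
have -> : realization_set (order_complex T) =
          @clique_pts K T (fun P Q => P >=< Q)%O [set: T]%SET.
  rewrite eqEsubset; split=> y.
    case=> y0 y1; rewrite inE => /forall_inP yK; split=> // u v yu yv.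
    have /forall_inP := yK u (ltac:(by rewrite inE)).
    by apply; rewrite inE.
  case=> y0 y1 _ yr; split=> //; rewrite inE.
  apply/forall_inP => u; rewrite inE => yu; apply/forall_inP => v.
  by rewrite inE => yv; exact: yr.
pose C := tope_sets B (base_fiber L' Sp Sm B) (base_differs Sp Sm B).
apply: (@contractible_in_reindex _ _ _ (@nested E') _ C
         (fun Q : T => separator_lift B (sval Q))).
- move=> P Q; rewrite /nested !separator_lift_subset -RB.
  by [].
- move=> P Q PQ; apply: le_anti.
  have PP : separator_lift B (sval P) \subset separator_lift B (sval P).
    exact: fintype.subxx.
  apply/andP; split; rewrite /Order.le /= /tope_le RB -!separator_lift_subset.
    by rewrite -PQ.
  by rewrite -PQ.
- move=> P; rewrite /C tope_sets_fiber //; apply/exists_inP/existsP.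
    by case=> Q QT /eqP ->; exists (exist _ Q QT).
  by case=> -[Q QT] /= /eqP ->; exists Q.
(* A coordinate outside [base_differs] and the free ones lies in [base_agrees], where [base_fiber]
   forces the sign of [B]. *)
apply: (@tope_sets_contractible _ _ _ _ _ (~: (Sp :|: Sm))%SET) => //.
- exact: base_fiber_COM.
- by rewrite inE BL; apply/forall_inP.
- move=> X e; rewrite inE => /andP[_ /forall_inP XB] eSF.
  apply/eqP/XB; move: eSF; rewrite !inE.
  by case: (e \in Sp); case: (e \in Sm); case: (B e == Pos);
    case: (B e == Neg).
- apply/set0Pn; exists (separator_lift B Q0).
  by rewrite tope_sets_fiber //; apply/exists_inP; exists Q0.
Qed.
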